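(* Let $X$ be a compact metric space, let $F:X\to 2^X$ be upper semi-continuous, and let $C=\bigcap_{n\in\mathbb{N}}F^n(X)$. Then $h(F)=h(F|_C)$.
   Context: $\mathbb{N}=\{1,2,\ldots\}$. For a compact metric space $X$ with metric $d$, $2^X$ is the set of non-empty compact subsets of $X$. $F:X\to 2^X$ is upper semi-continuous if for every $x\in X$ and every open $V\subseteq X$ containing $F(x)$ there is an open $U\ni x$ with $F(t)\subseteq V$ for all $t\in U$. Iterates: $F^0$ is the identity and $F^n=F\circ F^{n-1}$, where $(G\circ F)(x)=\bigcup_{y\in F(x)}G(y)$. For $A\subseteq X$, $F^n(A)=\bigcup_{x\in A}F^n(x)$. $F|_C$ is the restriction of $F$ to $C$, regarded as a set-valued function $C\to 2^C$. Entropy: for $n\in\mathbb{N}$, $\mathrm{Orb}_n(X,F)$ is the set of $n$-orbits, i.e. finite sequences $(x_0,\ldots,x_{n-1})$ in $X$ with $x_{i+1}\in F(x_i)$ for $0\le i\le n-2$, with the metric $D(\mathbf{x},\mathbf{y})=\max_{0\le i\le n-1}d(x_i,y_i)$. A subset of a metric space is $\epsilon$-separated if any two of its distinct points are at distance $\ge\epsilon$. $s_{n,\epsilon}(F)$ is the largest cardinality of an $\epsilon$-separated subset of $(\mathrm{Orb}_n(X,F),D)$, and the topological entropy of $F$ is $h(F)=\lim_{\epsilon\to0}\limsup_{n\to\infty}\frac1n\log s_{n,\epsilon}(F)\in[0,\infty]$. The entropy $h(F|_C)$ is defined in the same way for the compact metric space $C$ (with the metric $d$ restricted to $C$). *)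

(* Defs.v *)
From HB Require Import structures.
From mathcomp Require Import all_boot all_order all_algebra.
From mathcomp Require Import all_classical all_reals all_analysis.

Set Implicit Arguments.
Unset Strict Implicit.
Unset Printing Implicit Defensive.

Import Order.TTheory GRing.Theory Num.Theory.
Import numFieldNormedType.Exports.

Local Open Scope classical_set_scope.
Local Open Scope ring_scope.

(* MathComp-Analysis provides the topology and the balls induced on the subtype
   [set_type A]; this adds the restricted distance compatible with them. *)
Section subtype_metric.
Context {R : realType} {X : metricType R} (A : set X).

Let dist (x y : A) : R := mdist (val x) (val y).

Let dist_ge0 x y : 0 <= dist x y.
Proof. exact: mdist_ge0. Qed.

Let dist_positivity x y : dist x y = 0 -> x = y.
Proof. by move/mdist_positivity/val_inj. Qed.

Let ballEdist (x : A) (e : R) : ball x e = [set y | dist x y < e].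
Proof. by rewrite -initial_ballE ballEmdist. Qed.

HB.instance Definition _ := @PseudoMetric_isMetric.Build R (set_type A)
  dist dist_ge0 dist_positivity ballEdist.

End subtype_metric.

(* Together with [F : X -> set X], this says that F maps X to 2^X. *)
Definition compact_valued {X : topologicalType} (F : X -> set X) : Prop :=
  forall x, F x !=set0 /\ compact (F x).

Definition upper_semicontinuous {X : topologicalType} (F : X -> set X) : Prop :=
  forall (x : X) (V : set X), open V -> F x `<=` V ->
    exists U : set X, [/\ open U, U x & forall t, U t -> F t `<=` V].

Definition set_comp {X : Type} (G F : X -> set X) : X -> set X :=
  fun x => \bigcup_(y in F x) G y.

Definition set_iter {X : Type} (F : X -> set X) (n : nat) : X -> set X :=
  iter n (set_comp F) (fun x => [set x]).

Definition set_image {X : Type} (F : X -> set X) (A : set X) : set X :=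
  \bigcup_(x in A) F x.

Definition iter_core {X : Type} (F : X -> set X) : set X :=
  \bigcap_(n in [set n | (1 <= n)%N]) set_image (set_iter F n) setT.

(* The value of the restriction at x is F x viewed as a set of points of C; it
   loses no point when F x `<=` C, as happens for C = iter_core F (see
   iter_core_stable). *)
Definition set_restr {X : Type} (F : X -> set X) (C : set X) : C -> set C :=
  fun x => [set y | F (val x) (val y)].

Arguments set_restr {X} F C x.

Lemma iter_core_stable {X : Type} (F : X -> set X) (x : X) :
  iter_core F x -> F x `<=` iter_core F.
Proof.
move=> Cx y Fxy [|[|n]] //= _; first by exists x => //; exists x.
by have [z _ zx] := Cx n.+1 isT; exists z => //; exists x.
Qed.

Lemma set_restr_coreE {X : Type} (F : X -> set X) (x : iter_core F) :
  val @` set_restr F _ x = F (val x).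
Proof.
apply/seteqP; split=> [_ [y Fxy <-] //|y Fxy].
have Cy := iter_core_stable (set_valP x) Fxy.
by exists (exist _ y (mem_set Cy)).
Qed.

Section entropy.
Context {R : realType} {X : metricType R}.
Implicit Types (F : X -> set X) (n : nat) (eps : R).

Definition orbits F n : set (n.-tuple X) :=
  [set x | forall i j : 'I_n, j = i.+1 :> nat -> F (tnth x i) (tnth x j)].

Definition orbit_dist n (x y : n.-tuple X) : R :=
  \big[Num.max/0]_(i < n) mdist (tnth x i) (tnth y i).

Definition eps_separated {T : Type} (D : T -> T -> R) eps (E : set T) : Prop :=
  forall x y, E x -> E y -> x <> y -> eps <= D x y.

(* The largest cardinality of an eps-separated set, as a supremum in [0, +oo]. *)
Definition sep_num F n eps : \bar R :=
  ereal_sup [set counting E | E in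
    [set E : set (n.-tuple X) |
      E `<=` @orbits F n /\ eps_separated (@orbit_dist n) eps E]].

Definition sep_rate F eps : \bar R :=
  limn_esup (fun n => ((n%:R : R)^-1)%:E * lne (sep_num F n eps))%E.

Definition entropy F : \bar R := lim (sep_rate F eps @[eps --> 0^'+]).

End entropy.

(* Main.v *)
Require Import Defs.
From HB Require Import structures.
From mathcomp Require Import all_boot all_order all_algebra finmap ring zify.
From mathcomp Require Import all_classical all_reals all_analysis.

Set Implicit Arguments.
Unset Strict Implicit.
Unset Printing Implicit Defensive.

Import Order.TTheory GRing.Theory Num.Theory.
Import numFieldNormedType.Exports.

Local Open Scope classical_set_scope.
Local Open Scope ring_scope.

(** Write C for [iter_core F].  The inclusion of C in X is an isometry carrying
    orbits of the restriction to orbits of F, so the restriction has at most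
    the entropy of F ([le_entropy_isometry]).

    For the converse, fix eps > 0 and a block length m.  The sets F^N(X) are
    closed and decrease to C ([closed_iter_image]), hence F^N(X) enters any
    neighbourhood of C for N large ([iter_image_sub_nbhs_core]).  On the other
    hand, upper semi-continuity makes every orbit of length m that starts close
    enough to x stay eps-close to some orbit that starts at x
    ([near_shadowed]).  Together: for N large, each m-orbit starting in F^N(X)
    is eps-close to an m-orbit of C, hence 2 eps-close to a point of a maximal
    eps-separated set of m-orbits of C, which has at most
    S = [sep_num (set_restr F C) m eps] elements; if S is infinite, the bound
    below is void.

    Cut an orbit of length q + k m with q >= N into its first q points and k
    blocks of length m.  All blocks start in F^N(X).  Recording, for each of the
    first q points, its cell in a finite partition of X into b small cells, and
    for each block a close element of the separated set, determines the orbit up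
    to 4 eps; so the (4 eps)-separation number of F at this length is at most
    b^q S^k ([sep_num_blocks]).  With q bounded and the length tending to
    infinity, this gives
      [sep_rate F (4 * eps)] <= (1/m) log S   ([sep_rate_le_block])
    for every m >= 1, hence [sep_rate F (4 * eps)] is at most the rate of the
    restriction at eps ([sep_rate_le_core]).  Letting eps tend to 0 concludes. *)

(** * Counting and separated sets of orbits *)

Lemma counting_image {R : realType} {T U : choiceType} (f : T -> U) (A : set T) :
  {in A &, injective f} -> counting (f @` A) = counting A :> \bar R.
Proof.
move=> finj; rewrite /counting (eq_finite_set (inj_card_eq finj)).
case: asboolP => // Afin.
rewrite fset_set_image// card_in_imfset// => x y.
by rewrite !in_fset_set//; exact: finj.
Qed.

Lemma le_counting_card {R : realType} {T : finType} (A : set T) :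
  (counting A <= (#|T|%:R : R)%:E)%E.
Proof.
rewrite /counting asboolT; last exact: finite_finset.
rewrite lee_fin ler_nat -(card_uniqP (fset_uniq _)); exact: max_card.
Qed.

Section orbit_distance.
Context {R : realType} {X : metricType R}.
Implicit Types (F : X -> set X) (n : nat) (eps : R).

Lemma orbit_distP n eps (x y : n.-tuple X) : 0 < eps ->
  (orbit_dist x y < eps) <-> (forall i, mdist (tnth x i) (tnth y i) < eps).
Proof.
move=> eps0; split=> [/bigmax_ltP[_ H] i|H]; first exact: H.
by apply/bigmax_ltP; split=> // i _; exact: H.
Qed.

Lemma orbit_dist_sym n (x y : n.-tuple X) : orbit_dist x y = orbit_dist y x.
Proof. by apply: eq_bigr => i _; rewrite metric_sym. Qed.

Lemma orbit_distxx n (x : n.-tuple X) : orbit_dist x x = 0.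
Proof. by apply: big1_idem => [|i _]; [exact: maxxx|exact: mdistxx]. Qed.

End orbit_distance.

Section separation_numbers.
Context {R : realType} {X : metricType R}.
Implicit Types (F : X -> set X) (n : nat) (eps : R).

Lemma sep_num_ge0 F n eps : (0 <= sep_num F n eps)%E.
Proof.
apply: ereal_sup_ubound; exists set0; first by split=> [|x y].
by rewrite /counting asboolT// fset_set0 cardfs0.
Qed.

Lemma le_sep_num F n eps1 eps2 : eps1 <= eps2 ->
  (sep_num F n eps2 <= sep_num F n eps1)%E.
Proof.
move=> le12; apply: ereal_sup_le => _ [E [Eorb Esep] <-]; exists E => //.
split=> // x y Ex Ey xy; exact: le_trans le12 (Esep x y Ex Ey xy).
Qed.

(** A separated set meets each fibre of the code at most once. *)
Lemma sep_num_le_codes F n eps (T : finType) (c : n.-tuple X -> T) :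
  (forall x y, orbits F x -> orbits F y -> c x = c y -> orbit_dist x y < eps) ->
  (sep_num F n eps <= (#|T|%:R : R)%:E)%E.
Proof.
move=> csmall; apply: ge_ereal_sup => _ [E [Eorb Esep] <-].
rewrite -(@counting_image _ _ _ c); first exact: le_counting_card.
move=> x y /set_mem Ex /set_mem Ey cxy; apply: contrapT => xy.
have := csmall x y (Eorb _ Ex) (Eorb _ Ey) cxy.
by rewrite ltNge (Esep x y Ex Ey xy).
Qed.

(** Once separation numbers are finite, a separated set of largest cardinality
    exists, and by maximality no orbit is eps-far from all of its elements. *)
Lemma sep_num_net F n eps : 0 < eps -> (sep_num F n eps < +oo)%E ->
  exists (T : finType) (net : T -> n.-tuple X),
    ((#|T|%:R : R)%:E <= sep_num F n eps)%E /\
    forall x, orbits F x ->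
      exists t, orbits F (net t) /\ orbit_dist x (net t) < eps.
Proof.
move=> eps0 sfin.
have sfin_num : sep_num F n eps \is a fin_num.
  by rewrite ge0_fin_numE// sep_num_ge0.
(* Cardinalities being integers, a set within 1 of the supremum attains it. *)
have [_ [E [Eorb Esep] <-] Emax] := ub_ereal_sup_adherent ltr01 sfin_num.
have Efin : finite_set E.
  apply: contrapT => Einf; have : (counting E <= sep_num F n eps)%E.
    by apply: ereal_sup_ubound; exists E.
  by rewrite /counting asboolF// leye_eq => /eqP sE; rewrite sE in sfin.
have cE : counting E = (#|` fset_set E|%:R : R)%:E by rewrite /counting asboolT.
exists (fset_set E), val; split.
  by rewrite -cardfE -cE; apply: ereal_sup_ubound; exists E.
move=> x xorb; apply: contrapT => xfar.
have far y : E y -> eps <= orbit_dist x y.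
  move=> Ey; rewrite leNgt; apply/negP => xy; apply: xfar.
  have yE : y \in fset_set E by rewrite in_fset_set// inE.
  by exists [` yE]%fset; split=> //; exact: Eorb.
have xE : ~ E x by move=> /far; rewrite orbit_distxx leNgt eps0.
have : (counting (x |` E) <= sep_num F n eps)%E.
  apply: ereal_sup_ubound; exists (x |` E) => //; split.
    by move=> y [->//|/Eorb].
  move=> y z [->|Ey] [->|Ez] yz //; first exact: far.
    by rewrite orbit_dist_sym; exact: far.
  exact: Esep.
rewrite /counting asboolT; last by rewrite finite_setU; split.
rewrite fset_setU1// cardfsU1 in_fset_set// memNset//= leNgt.
move: Emax; rewrite cE -/(sep_num F n eps) lteBlDr// => /lt_le_trans -> //.
by rewrite -EFinD lee_fin natrD addrC.
Qed.

End separation_numbers.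

(** * Comparing entropies *)

Section sep_rate_comparison.
Context {R : realType}.

Lemma le_limn_esup (u v : (\bar R)^nat) :
  (\forall n \near \oo, (u n <= v n)%E) -> (limn_esup u <= limn_esup v)%E.
Proof.
move=> uv; apply: le_ereal_inf_tmp => _ [V Voo <-].
apply: (@le_trans _ _ (ereal_sup (u @` (V `&` [set n | (u n <= v n)%E])))).
  apply: ereal_inf_lbound; exists (V `&` [set n | (u n <= v n)%E]) => //.
  exact: filterI.
apply: ge_ereal_sup => _ [n [Vn uvn] <-]; apply: le_trans uvn _.
by apply: ereal_sup_ubound; exists n.
Qed.

Lemma le_lne (x y : \bar R) : (0 <= x)%E -> (x <= y)%E -> (lne x <= lne y)%E.
Proof.
move=> x0 xy; rewrite lee_lne// in_itv/= leey andbT//; exact: le_trans xy.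
Qed.

Lemma le_sep_rate {X Y : metricType R} (F : X -> set X) (G : Y -> set Y) d e :
  (forall n, sep_num F n d <= sep_num G n e)%E ->
  (sep_rate F d <= sep_rate G e)%E.
Proof.
move=> FG; apply: le_limn_esup; apply: nearW => n.
apply: lee_wpmul2l; first by rewrite lee_fin invr_ge0.
by apply: le_lne; first exact: sep_num_ge0.
Qed.

(** The rate is nonincreasing in eps, so its limit at 0 is a supremum. *)
Lemma entropyE {X : metricType R} (F : X -> set X) :
  entropy F = ereal_sup [set sep_rate F eps | eps in [set eps | 0 < eps]].
Proof.
have -> : [set eps : R | 0 < eps] = [set` `]0, +oo[%R].
  by apply/seteqP; split=> x /=; rewrite in_itv/= andbT.
apply/cvg_lim => //; apply: nonincreasing_at_right_cvge => // x y _ _ xy.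
by apply: le_sep_rate => n; exact: le_sep_num.
Qed.

Lemma le_entropy {X Y : metricType R} (F : X -> set X) (G : Y -> set Y) :
  (forall d, 0 < d -> exists2 e, 0 < e & (sep_rate F d <= sep_rate G e)%E) ->
  (entropy F <= entropy G)%E.
Proof.
move=> FG; rewrite !entropyE; apply: ge_ereal_sup => _ [d /FG[e e0 de] <-].
by apply: le_trans de _; apply: ereal_sup_ubound; exists e.
Qed.

Lemma le_entropy_isometry {X Y : metricType R} (F : X -> set X)
    (G : Y -> set Y) (f : X -> Y) :
  (forall x x', mdist (f x) (f x') = mdist x x') ->
  (forall x x', F x x' -> G (f x) (f x')) ->
  (entropy F <= entropy G)%E.
Proof.
move=> fiso fFG; apply: le_entropy => d d0; exists d => //.
apply: le_sep_rate => n; apply: ge_ereal_sup => _ [E [Eorb Esep] <-].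
have finj : injective f.
  by move=> x y fxy; apply: mdist_positivity; rewrite -fiso fxy mdistxx.
pose fn : n.-tuple X -> n.-tuple Y := map_tuple f.
have fninj : injective fn.
  move=> x y xy; apply: eq_from_tnth => i; apply: finj.
  by have := congr1 (fun t => tnth t i) xy; rewrite /= !tnth_map.
rewrite -(@counting_image _ _ _ fn); last by move=> x y _ _; exact: fninj.
apply: ereal_sup_ubound; exists (fn @` E) => //; split.
  by move=> _ [x Ex <-] i j ij; rewrite !tnth_map; exact/fFG/(Eorb _ Ex).
move=> _ _ [x Ex <-] [y Ey <-] xy.
rewrite (_ : orbit_dist _ _ = orbit_dist x y).
  by apply: Esep => // exy; apply: xy; rewrite exy.
by apply: eq_bigr => i _; rewrite !tnth_map fiso.
Qed.

End sep_rate_comparison.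

(** * The iterated images decrease to the core *)

Lemma usc_near {X : topologicalType} (F : X -> set X) (x : X) (V : set X) :
  upper_semicontinuous F -> open V -> F x `<=` V ->
  \forall y \near x, F y `<=` V.
Proof.
move=> uscF Vo /(uscF _ _ Vo)[U [Uo Ux UV]].
by apply: filterS UV _; exact: open_nbhs_nbhs.
Qed.

Section image_closed.
Context {R : realType} {X : metricType R}.
Implicit Types F : X -> set X.

(** If y is outside F(A), each x in A has disjoint neighbourhoods of y and of
    F x; by upper semi-continuity the latter contains F x' for x' near x, and
    compactness of A makes one neighbourhood of y work for all x. *)
Lemma closed_set_image F (A : set X) : compact_valued F ->
  upper_semicontinuous F -> compact A -> closed (set_image F A).
Proof.
move=> cptF uscF /compact_near_coveringP covA y yclos.
apply: contrapT => yFA.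
have : \forall z \near y, A `<=` [set x | ~ F x z].
  apply: covA => x Ax.
  have Fxclosed : closed (F x).
    by apply: compact_closed; [exact: metric_hausdorff|have [] := cptF x].
  have yFx : ~ F x y by move=> Fxy; apply: yFA; exists x.
  have : nbhs y (~` F x).
    by apply: open_nbhs_nbhs; split=> //; exact: closed_openC.
  move=> /nbhs_ballP[_/posnumP[e] yeF].
  pose V := (~` ball y (e%:num / 2))°.
  have FxV : F x `<=` V.
    move=> z Fxz; apply/nbhs_ballP; exists (e%:num / 2) => //= t zt yt.
    apply: yeF Fxz; rewrite (splitr e%:num).
    exact: ball_triangle yt (ball_sym zt).
  exists ([set x' | F x' `<=` V], ball y (e%:num / 2)).
    split; first by apply: usc_near => //; exact: open_interior.
    exact: nbhsx_ballx.
  by move=> [x' z] [/= FV yz] /FV/interior_subset.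
move=> /yclos[z [[x Ax Fxz] /(_ x Ax)]].
exact.
Qed.

End image_closed.

Section core.
Context {X : Type}.
Implicit Types F : X -> set X.

Definition iter_image F n : set X := set_image (set_iter F n) setT.

Lemma iter_image0 F : iter_image F 0 = setT.
Proof. by apply/seteqP; split=> // x _; exists x. Qed.

Lemma iter_imageS F n : iter_image F n.+1 = set_image F (iter_image F n).
Proof.
apply/seteqP; split=> [y [x _ [z xz zy]]|y [z [x _ xz] zy]].
  by exists z => //; exists x.
by exists x => //; exists z.
Qed.

Lemma iter_image_decr F m n : (m <= n)%N -> iter_image F n `<=` iter_image F m.
Proof.
move=> mn; rewrite -(subnK mn); elim: (n - m)%N => // k IH.
apply: subset_trans IH; rewrite addSn; elim: (k + m)%N => [|l IH].
  by rewrite iter_image0.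
by rewrite iter_imageS => y [x /IH xl xy]; rewrite iter_imageS; exists x.
Qed.

Lemma iter_coreP F x : iter_core F x <-> forall n, iter_image F n x.
Proof.
split=> [Cx [|n]|Cx n _]; [by rewrite iter_image0|exact: Cx|exact: Cx].
Qed.

End core.

Section iterated_images.
Context {R : realType} {X : metricType R}.
Implicit Types F : X -> set X.

Lemma closed_iter_image F n : compact [set: X] -> compact_valued F ->
  upper_semicontinuous F -> closed (iter_image F n).
Proof.
move=> cptX cptF uscF; elim: n => [|n IH].
  by rewrite iter_image0; exact: closedT.
rewrite iter_imageS; apply: closed_set_image => //.
exact: subclosed_compact cptX _.
Qed.

(** The closed sets F^n(X) minus W are nested with empty intersection, so one of
    them is empty by compactness. *)
Lemma iter_image_sub_nbhs_core F (W : set X) : compact [set: X] ->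
  compact_valued F -> upper_semicontinuous F -> open W -> iter_core F `<=` W ->
  exists N, iter_image F N `<=` W.
Proof.
move=> cptX cptF uscF Wo CW.
have [N _ NW] : \forall N \near \oo,
    [set: X] `<=` [set x | iter_image F N x -> W x].
  move: (cptX) => /compact_near_coveringP; apply => x _.
  have [/CW Wx|nCx] := pselect (iter_core F x).
    exists (W, setT); first by split; [exact: open_nbhs_nbhs|exact: filterT].
    by move=> [x' n] [/= Wx' _] _.
  have [n nx] : exists n, ~ iter_image F n x.
    by apply/existsNP => H; apply: nCx; exact/iter_coreP.
  exists (~` iter_image F n, [set k | (n <= k)%N]).
    split; last exact: nbhs_infty_ge.
    by apply: open_nbhs_nbhs; split=> //; exact/closed_openC/closed_iter_image.
  by move=> [x' k] [/= x'n nk] x'k; case: x'n; exact: iter_image_decr nk _ x'k.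
by exists N => x /(NW N (leqnn N)); exact.
Qed.

End iterated_images.

(** * Shadowing by orbits of the core *)

Section walks.
Context {R : realType} {X : metricType R}.
Implicit Types (F : X -> set X) (u v : nat -> X).

(** Infinite sequences whose first m steps follow F stand for orbits of length
    m + 1: shifts and concatenations then need no change of type. *)
Definition walk F m u := forall i, (i < m)%N -> F (u i) (u i.+1).

Definition shadowed F m (eps : R) x y := forall u, u 0%N = y -> walk F m u ->
  exists v, [/\ v 0%N = x, walk F m v &
    forall i, (i <= m)%N -> mdist (u i) (v i) < eps].

(** By induction on m: points close to some z in F x have their m-walks
    shadowed from that z, and they form an open set containing F x, which by
    upper semi-continuity contains F y for y near x.  Prepend x to the walk
    obtained from z. *)
Lemma near_shadowed F m (eps : R) x : upper_semicontinuous F -> 0 < eps ->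
  \forall y \near x, shadowed F m eps x y.
Proof.
move=> uscF eps0; elim: m x => [|m IH] x.
  near=> y => u u0 _; exists (fun=> x); split=> // i; rewrite leqn0 => /eqP ->.
  rewrite u0 metric_sym; near: y.
  by have := @nbhsx_ballx _ _ x _ eps0; rewrite ballEmdist.
pose V := \bigcup_(z in F x) (shadowed F m eps z)°.
have Vo : open V by apply: bigcup_open => z _; exact: open_interior.
have FV : F x `<=` V by move=> z Fxz; exists z => //; exact: IH.
near=> y => u u0 uw.
have /(_ (u 1%N))[] : F y `<=` V by near: y; exact: usc_near.
  by rewrite -u0; exact: uw.
move=> z Fxz /interior_subset zu.
have [] := zu (fun i => u i.+1) erefl; first by move=> i im; exact: uw.
move=> v [v0 vw vu]; exists (fun i => if i is j.+1 then v j else x); split=> //.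
  by move=> [_|i im]; [rewrite v0|exact: vw].
move=> [_|i im]; last exact: vu.
rewrite u0 metric_sym; near: y.
by have := @nbhsx_ballx _ _ x _ eps0; rewrite ballEmdist.
Unshelve. all: by end_near. Qed.

Lemma iter_image_shadowed F m (eps : R) : compact [set: X] ->
  compact_valued F -> upper_semicontinuous F -> 0 < eps ->
  exists N, forall y, iter_image F N y ->
    exists2 x, iter_core F x & shadowed F m eps x y.
Proof.
move=> cptX cptF uscF eps0.
pose W := \bigcup_(x in iter_core F) (shadowed F m eps x)°.
have [| |N NW] := @iter_image_sub_nbhs_core _ _ F W cptX cptF uscF.
- by apply: bigcup_open => x _; exact: open_interior.
- by move=> x Cx; exists x => //; exact: near_shadowed.
by exists N => y /NW[x Cx /interior_subset]; exists x.
Qed.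

(** Total boundedness, as a colouring whose cells are small: x is coloured by the
    first centre of a finite (eps/2)-net that is close to it. *)
Lemma finite_partition (eps : R) : compact [set: X] -> 0 < eps ->
  exists (b : nat) (c : X -> 'I_b.+1),
    forall x y, c x = c y -> mdist x y < eps.
Proof.
move=> /compact_near_coveringP cptX eps0.
have e0 : 0 < eps / 2 by rewrite divr_gt0.
(* Eventually along this filter means: for all large enough finite sets. *)
pose up (s : seq X) := [set t : seq X | {subset s <= t}].
have upF : Filter (filter_from setT up).
  apply: filter_from_filter; first by exists [::].
  move=> s t _ _; exists (s ++ t) => // r str.
  by split=> x xs; apply: str; rewrite mem_cat xs ?orbT.
have [s _ scov] : \forall s \near filter_from setT up,
    [set: X] `<=` [set x | has (fun z => mdist z x < eps / 2) s].
  apply: cptX => x _; exists (ball x (eps / 2), up [:: x]).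
    by split; [exact: nbhsx_ballx|exists [:: x]].
  move=> [x' t] [/= xx' xt]; apply/hasP; exists x.
    by apply: xt; exact: mem_head.
  by move: xx'; rewrite ballEmdist.
have {}scov x : has (fun z => mdist z x < eps / 2) s by exact: (scov s).
exists (size s), (fun x => inord (find (fun z => mdist z x < eps / 2) s)).
move=> x y /(congr1 val); rewrite /= !inordK ?ltnS ?find_size// => xy.
have := nth_find x (scov x); have := nth_find x (scov y); rewrite -xy /=.
set z := nth _ _ _ => zy zx; rewrite (splitr eps).
by apply: le_lt_trans (metric_triangle x z y) _; rewrite ltrD// metric_sym.
Qed.

End walks.

Section orbits_and_walks.
Context {R : realType} {X : metricType R}.
Implicit Types (F : X -> set X).

Lemma walk_nth F n (x0 : X) (x : n.-tuple X) :
  orbits F x -> walk F n.-1 (nth x0 x).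
Proof.
move=> xorb i; case: n x xorb => [|n] x xorb //= ilt.
have := xorb (Ordinal (ltnW ilt : i < n.+1)%N) (Ordinal (ilt : i.+1 < n.+1)%N).
by rewrite !(tnth_nth x0)/=; apply.
Qed.

Lemma orbits_mktuple F n (u : nat -> X) :
  walk F n.-1 u -> orbits F [tuple u i | i < n].
Proof.
move=> uw i j ij; rewrite !tnth_mktuple ij; apply: uw.
by rewrite -ltnS -ij; case: n i j ij => [[]|n i j _] //=.
Qed.

Lemma iter_image_walk F m n (u : nat -> X) : walk F m u ->
  forall i, (i <= m)%N -> iter_image F n (u 0%N) -> iter_image F (n + i) (u i).
Proof.
move=> uw; elim=> [|i IH] im u0; first by rewrite addn0.
rewrite addnS iter_imageS; exists (u i); last exact: uw.
by apply: IH => //; exact: ltnW.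
Qed.

Lemma iter_core_walk F m (u : nat -> X) : walk F m u -> iter_core F (u 0%N) ->
  forall i, (i <= m)%N -> iter_core F (u i).
Proof.
move=> uw u0; elim=> [|i IH] im //.
by apply: iter_core_stable (uw i im); apply: IH; exact: ltnW.
Qed.

(** The core is stable under F, so a walk that starts in it is an orbit of the
    restriction. *)
Lemma orbits_core_lift F n (v : nat -> X) : walk F n.-1 v ->
  iter_core F (v 0%N) ->
  exists w : n.-tuple (iter_core F),
    orbits (set_restr F (iter_core F)) w /\
    forall i, val (tnth w i) = v i.
Proof.
move=> vw v0.
have /choice[g gv] : forall i : 'I_n, exists c : iter_core F, val c = v i.
  move=> i; have Cvi : iter_core F (v i).
    by apply: iter_core_walk vw v0 _ _; rewrite -ltnS; case: n i => [[]|n i]/=.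
  by exists (exist _ (v i) (mem_set Cvi)).
exists [tuple g i | i < n]; split=> [i j ij|i]; last by rewrite tnth_mktuple.
rewrite /set_restr/= !tnth_mktuple !gv.
by have := orbits_mktuple vw ij; rewrite !tnth_mktuple.
Qed.

End orbits_and_walks.

(** * Coding orbits by blocks *)

Section block_coding.
Context {R : realType} {X : metricType R} (F : X -> set X).
Hypotheses (cptX : compact [set: X]) (cptF : compact_valued F).
Hypothesis (uscF : upper_semicontinuous F).
Variable x0 : X.
Local Notation G := (set_restr F (iter_core F)).

(** Each orbit starting in F^N(X) is eps-close to an orbit of the core, which is
    eps-close to an element of the net; the code is this element.  Two orbits
    with the same code are thus at distance less than 2 eps + 2 eps. *)
Lemma block_code m (eps : R) : 0 < eps -> (sep_num G m.+1 eps < +oo)%E ->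
  exists (N : nat) (T : finType) (c : m.+1.-tuple X -> T),
  [/\ (0 < #|T|)%N, ((#|T|%:R : R)%:E <= sep_num G m.+1 eps)%E &
    forall u v, orbits F u -> orbits F v ->
      iter_image F N (nth x0 u 0) -> iter_image F N (nth x0 v 0) ->
      c u = c v -> orbit_dist u v < 4 * eps].
Proof.
move=> eps0 /(sep_num_net eps0)[T [net [Tle netP]]].
have [N NP] := iter_image_shadowed m cptX cptF uscF eps0.
have near_net (u : m.+1.-tuple X) : orbits F u -> iter_image F N (nth x0 u 0) ->
    exists t, forall i, mdist (tnth u i) (val (tnth (net t) i)) < 2 * eps.
  move=> uorb /NP[x Cx] /(_ _ erefl (walk_nth x0 uorb))[v [v0 vw vu]].
  have [|w [worb wv]] := @orbits_core_lift _ _ F m.+1 v vw; first by rewrite v0.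
  have [t [_ /orbit_distP-/(_ eps0) wt]] := netP w worb.
  exists t => i; rewrite mulr2n mulrDl mul1r.
  apply: le_lt_trans (metric_triangle _ (v i) _) _; apply: ltrD.
    by rewrite (tnth_nth x0); apply: vu; rewrite -ltnS.
  by rewrite -wv; exact: wt.
(* Any orbit supplies t0, the code of the tuples that need none. *)
have /choice[f fF] : forall x, exists y, F x y.
  by move=> x; have [] := cptF x.
pose u0 := [tuple iter (N + i) f x0 | i < m.+1].
have [t0 _] : exists t, forall i,
    mdist (tnth u0 i) (val (tnth (net t) i)) < 2 * eps.
  apply: near_net.
    by apply: (@orbits_mktuple _ _ _ _ (fun i => iter (N + i) f x0)) => i _;
      rewrite addnS; exact: fF.
  rewrite -(tnth_nth x0 _ ord0) tnth_mktuple addn0.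
  rewrite -[N in iter_image F N]add0n.
  by apply: (@iter_image_walk _ _ F N _ (fun i => iter i f x0)) => //;
    rewrite iter_image0.
have /choice[c cP] : forall u : m.+1.-tuple X, exists t,
    orbits F u -> iter_image F N (nth x0 u 0) ->
    forall i, mdist (tnth u i) (val (tnth (net t) i)) < 2 * eps.
  move=> u; have [[uorb uN]|no] :=
    pselect (orbits F u /\ iter_image F N (nth x0 u 0)).
    by have [t tP] := near_net u uorb uN; exists t.
  by exists t0 => uorb uN; exfalso; exact: no.
exists N, T, c; split=> //; first by apply/card_gt0P; exists t0.
move=> u v uorb vorb uN vN cuv; apply/orbit_distP; first by rewrite mulr_gt0.
move=> i; rewrite (_ : 4 * eps = 2 * eps + 2 * eps); last by ring.
apply: le_lt_trans (metric_triangle _ (val (tnth (net (c u)) i)) _) _.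
by rewrite ltrD ?cP// metric_sym cuv cP.
Qed.


Lemma sep_num_blocks m (eps : R) : 0 < eps -> (sep_num G m.+1 eps < +oo)%E ->
  exists (N b S : nat),
  [/\ (0 < b)%N, (0 < S)%N, ((S%:R : R)%:E <= sep_num G m.+1 eps)%E &
    forall q k, (N <= q)%N ->
      (sep_num F (q + k * m.+1) (4 * eps) <= ((b ^ q * S ^ k)%N%:R : R)%:E)%E].
Proof.
move=> eps0 sfin; have eps40 : 0 < 4 * eps by rewrite mulr_gt0.
have [N [T [c [T0 Tle cP]]]] := block_code eps0 sfin.
have [b [d dP]] := finite_partition cptX eps40.
exists N, b.+1, #|T|; split=> // q k Nq.
pose block (x : (q + k * m.+1).-tuple X) (j : nat) : m.+1.-tuple X :=
  [tuple nth x0 x (q + j * m.+1 + l) | l < m.+1].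
pose code (x : (q + k * m.+1).-tuple X) := ([ffun i : 'I_q => d (nth x0 x i)],
                [ffun j : 'I_k => c (block x j)]).
have blockP x j : orbits F x -> (j < k)%N ->
    orbits F (block x j) /\ iter_image F N (nth x0 (block x j) 0).
  move=> xorb jk; have xw := walk_nth x0 xorb.
  have jkm : (q + j * m.+1 + m.+1 <= q + k * m.+1)%N.
    by rewrite -addnA leq_add2l -mulSnr leq_mul2r jk.
  split.
    apply: (@orbits_mktuple _ _ F m.+1 (fun l => nth x0 x (q + j * m.+1 + l))).
    by move=> l lm; rewrite addnS; apply: xw; lia.
  rewrite -(tnth_nth x0 _ ord0) tnth_mktuple addn0.
  apply: (@iter_image_decr _ F N (0 + (q + j * m.+1))); first lia.
  by apply: (iter_image_walk xw); [lia|rewrite iter_image0].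
apply: le_trans (sep_num_le_codes (c := code) _) _; last first.
  by rewrite card_prod !card_ffun !card_ord.
move=> x y xorb yorb [/ffunP qxy /ffunP kxy].
apply/orbit_distP => // i; have [iq|qi] := ltnP i q.
  by have := qxy (Ordinal iq); rewrite !ffunE/= !(tnth_nth x0); exact: dP.
pose j := ((i - q) %/ m.+1)%N.
have jk : (j < k)%N by rewrite ltn_divLR// ltn_subLR.
have [xb xN] := blockP x j xorb jk; have [yb yN] := blockP y j yorb jk.
have := kxy (Ordinal jk); rewrite !ffunE/= => /(cP _ _ xb yb xN yN).
move=> /(orbit_distP _ _ eps40)/(_ (Ordinal (ltn_pmod (i - q) (ltn0Sn m)))).
by rewrite !tnth_mktuple/= -addnA -divn_eq subnKC// !(tnth_nth x0).
Qed.

(** With l = m + 1, a length n > N is q + k l for some q between N and N + l.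
    Then log (b^q S^k) / n <= (N + l) log b / n + (log S) / l, where the first
    term on the right vanishes as n grows. *)
Lemma sep_rate_le_block m (eps : R) : 0 < eps ->
  (sep_rate F (4 * eps) <= (m.+1%:R^-1)%:E * lne (sep_num G m.+1 eps))%E.
Proof.
move=> eps0; have [sfin|] := ltP (sep_num G m.+1 eps) +oo%E; last first.
  by rewrite leye_eq => /eqP ->; rewrite gt0_muley ?leey// lte_fin invr_gt0.
have [N [b [S [b0 S0 Sle blocks]]]] := sep_num_blocks eps0 sfin.
have lnb0 : 0 <= ln (b%:R : R) by rewrite ln_ge0// ler1n.
have lnS0 : 0 <= ln (S%:R : R) by rewrite ln_ge0// ler1n.
apply: (@le_trans _ _ (m.+1%:R^-1 * ln (S%:R : R))%:E); last first.
  rewrite EFinM -lne_EFin ?ltr0n//; apply: lee_wpmul2l.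
    by rewrite lee_fin invr_ge0.
  by apply: le_lne => //; rewrite lee_fin.
pose A : R := (N + m.+1)%:R * ln b%:R.
pose v n : R := n%:R^-1 * A + m.+1%:R^-1 * ln S%:R.
have vcvg : (v n)%:E @[n --> \oo] --> (m.+1%:R^-1 * ln (S%:R : R))%:E.
  apply: cvg_EFin; first exact: nearW.
  rewrite -[X in _ --> X]add0r -(mul0r A); apply: cvgD; last exact: cvg_cst.
  apply: cvgM; last exact: cvg_cst.
  apply/gtr0_cvgV0; last exact: cvgr_idn.
  by near=> n; rewrite ltr0n; near: n; exists 1%N.
rewrite -(cvg_lim _ vcvg)// -is_cvg_limn_esupE; last first.
  by apply/cvg_ex; eexists; exact: vcvg.
apply: le_limn_esup; near=> n.
have Nn : (N < n)%N by near: n; exact: nbhs_infty_gt.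
have n0 : 0 < n%:R :> R by rewrite ltr0n (leq_ltn_trans _ Nn).
pose k := ((n - N) %/ m.+1)%N; pose q := (n - k * m.+1)%N.
have kle : (k * m.+1 <= n - N)%N by exact: leq_trunc_div.
have Nq : (N <= q)%N by rewrite /q; lia.
have qle : (q <= N + m.+1)%N.
  by have := ltn_ceil (n - N) (ltn0Sn m); rewrite -/k /q; lia.
have nqk : (n = q + k * m.+1)%N by rewrite /q; lia.
have := blocks q k Nq; rewrite -nqk => le_blocks.
apply: (@le_trans _ _ (n%:R^-1%:E * lne ((b ^ q * S ^ k)%N%:R : R)%:E)%E).
  apply: lee_wpmul2l; first by rewrite lee_fin invr_ge0.
  by apply: le_lne => //; exact: sep_num_ge0.
have bq0 : 0 < (b ^ q)%N%:R :> R by rewrite ltr0n expn_gt0 b0.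
have Sk0 : 0 < (S ^ k)%N%:R :> R by rewrite ltr0n expn_gt0 S0.
rewrite natrM lne_EFin ?mulr_gt0// lnM ?posrE// !natrX !lnXn ?ltr0n//.
rewrite -EFinM lee_fin mulrDr /v; apply: lerD.
  by rewrite ler_pM2l ?invr_gt0// -[ln _ *+ q]mulr_natl ler_wpM2r// ler_nat.
rewrite -[ln _ *+ k]mulr_natl mulrA ler_wpM2r//.
rewrite ler_pdivrMl// ler_pdivlMr ?ltr0n//.
by rewrite -natrM ler_nat (leq_trans kle)// leq_subr.
Unshelve. all: by end_near. Qed.

(** The bound of [sep_rate_le_block] has a left-hand side independent of m, so
    it passes to the upper limit over m. *)
Lemma sep_rate_le_core (eps : R) : 0 < eps ->
  (sep_rate F (4 * eps) <= sep_rate G eps)%E.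
Proof.
move=> eps0.
have -> : sep_rate F (4 * eps) = limn_esup (fun=> sep_rate F (4 * eps)).
  rewrite is_cvg_limn_esupE; last exact: is_cvg_cst.
  by rewrite lim_cst.
apply: le_limn_esup; near=> n.
have n0 : (0 < n)%N by near: n; exact: nbhs_infty_gt.
by rewrite -(prednK n0); exact: sep_rate_le_block.
Unshelve. all: by end_near. Qed.

End block_coding.

Theorem lemma3p4 (R : realType) (X : metricType R) (F : X -> set X)
    (cptX : compact [set: X]) (cptF : compact_valued F)
    (uscF : upper_semicontinuous F) :
  entropy F = entropy (set_restr F (iter_core F)).
Proof.
apply/eqP; rewrite eq_le; apply/andP; split; last first.
  by apply: (@le_entropy_isometry R (set_type (iter_core F)) X _ _ val).
have [[x0 _]|X0] := pselect ([set: X] !=set0).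
  apply: le_entropy => d d0; exists (d / 4); first by rewrite divr_gt0.
  rewrite -[in leLHS](@mulfVK _ 4 _ d)// mulrC.
  by apply: sep_rate_le_core => //; rewrite divr_gt0.
(* If X is empty, so is the core, and the two systems are isometric. *)
have empty (x : X) : False by apply: X0; exists x.
by apply: (@le_entropy_isometry R X (set_type (iter_core F)) _ _
  (fun x => match empty x with end)).
Qed.
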